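(* For every integer $\kappa\ge 0$ there exists $c$ such that if $G$ is a digraph with $\omega(G)\le\kappa$ and $\chi(G)>c$, then some long hole of $G$ is disoriented.
   Context: Digraphs are finite, with no loops, parallel edges or antiparallel pairs; $G^*$ denotes the underlying undirected graph, and $\chi(G),\omega(G)$ are the chromatic and clique numbers of $G^*$. A hole of a graph is an induced cycle of length at least four; a hole of a digraph $G$ is an induced subdigraph $C$ such that $C^*$ is a hole of $G^*$. A long hole is a hole of length at least five. A hole $C$ of a digraph is directed if every vertex has outdegree exactly one in $C$; alternating if every vertex has outdegree two or zero in $C$; and disoriented if it is neither directed nor alternating. *)

(* Defs.v *)
From mathcomp Require Import all_boot.
Set Implicit Arguments. Unset Strict Implicit. Unset Printing Implicit Defensive.

(* A digraph on a finite vertex type V is a relation adj (adj x y = edge x->y)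
   with no loops and no antiparallel pairs (parallel edges are impossible for a relation). *)
Definition digraph (V : finType) (adj : rel V) : Prop :=
  forall x y, adj x y -> ~~ adj y x.

Definition und (V : finType) (adj : rel V) : rel V := fun x y => adj x y || adj y x.

Definition colorableb (V : finType) (adj : rel V) (k : nat) : bool :=
  [exists f : {ffun V -> 'I_k}, [forall x, forall y, und adj x y ==> (f x != f y)]].

(* chromatic number chi(G) = least k with a proper k-colouring of G^* (k <= #|V| always works) *)
Definition chi (V : finType) (adj : rel V) : nat :=
  find (colorableb adj) (iota 0 #|V|.+1).

Definition cliqueb (V : finType) (adj : rel V) (A : {set V}) : bool :=
  [forall x in A, forall y in A, (x != y) ==> und adj x y].

Definition omega (V : finType) (adj : rel V) : nat :=
  \max_(A : {set V} | cliqueb adj A) #|A|.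

(* A hole, given by the cyclic sequence of its vertices s = [v_0; ...; v_{n-1}]:
   distinct vertices, n >= 4, and v_i, v_j adjacent in G^* iff they are cyclically consecutive
   (i.e. the induced subgraph of G^* on these vertices is a cycle of length n). *)
Definition hole (V : finType) (adj : rel V) (s : seq V) : Prop :=
  [/\ uniq s, 4 <= size s &
      forall (x0 : V) i j, i < size s -> j < size s ->
        und adj (nth x0 s i) (nth x0 s j) =
        ((j == i.+1 %% size s) || (i == j.+1 %% size s))].

Definition long_hole (V : finType) (adj : rel V) (s : seq V) : Prop :=
  hole adj s /\ 5 <= size s.

Definition outdeg_in (V : finType) (adj : rel V) (s : seq V) (v : V) : nat :=
  #|[set u : V | (u \in s) && adj v u]|.

Definition directed_hole (V : finType) (adj : rel V) (s : seq V) : Prop :=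
  forall v, v \in s -> outdeg_in adj s v = 1.

Definition alternating_hole (V : finType) (adj : rel V) (s : seq V) : Prop :=
  forall v, v \in s -> (outdeg_in adj s v = 2) \/ (outdeg_in adj s v = 0).

Definition disoriented_hole (V : finType) (adj : rel V) (s : seq V) : Prop :=
  ~ directed_hole adj s /\ ~ alternating_hole adj s.

(* Main.v *)
Require Import Defs.
From mathcomp Require Import all_boot.
From Stdlib Require Import Classical_Prop.

(* Suppose that no long hole is disoriented. By induction on the clique number, sets of vertices
   without a clique of size [kappa + 1] are [tau]-colourable. Let the levels be those of a
   breadth-first search, and let [u] assign to each vertex of a set [B] a neighbour outside, usually
   a parent. If for each edge of [B] the [u] of one end, chosen consistently with a ranking of [B],
   is adjacent to both ends, then every clique of [B] extends, so [B] is [tau]-colourable.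
   After a bounded partition of a level by first parents and orientations, an edge [x y] violating
   this has [u x] adjacent to [u y]: otherwise [u x, x, y, u y] closes through the earlier levels
   to a long disoriented hole. A proper colouring of the previous level rules this out, and so the
   balls of any fixed radius have bounded chromatic number.
   For an arbitrary level, rank its vertices by their first grandparent [g]. If [u x], [u y] are
   adjacent, then a path starting at [u y] and leading, through vertices ranked after [x], far away
   from [u y] can be preceded either by [g y, u y] or by [g x, u x, u y]. Both paths close through
   the earlier levels to long holes that are not directed, and they cannot both be alternating.
   Hence the level has chromatic number bounded independently of its depth. *)

Set Implicit Arguments.
Unset Strict Implicit.
Unset Printing Implicit Defensive.

(** * Colourings of vertex sets *)

Section Colouring.

Variables (V : finType) (e : rel V).
Implicit Types A B : {set V}.

(** Colours are natural numbers given on all of [V] and constrained only on [A], so colourings of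
    different sets combine without subtypes. *)
Definition colorable A k :=
  exists2 c : V -> nat, (forall x, x \in A -> c x < k) &
    forall x y, x \in A -> y \in A -> e x y -> c x != c y.

Lemma colorableS A B k l :
  A \subset B -> k <= l -> colorable B k -> colorable A l.
Proof.
move=> /subsetP sAB le_kl [c ck ce]; exists c => [x Ax|x y Ax Ay].
  exact: leq_trans (ck x (sAB x Ax)) le_kl.
by apply: ce; apply: sAB.
Qed.

Lemma colorable1 x : irreflexive e -> colorable [set x] 1.
Proof.
move=> irr; exists (fun=> 0) => // y z; rewrite !inE => /eqP-> /eqP->.
by rewrite irr.
Qed.

Lemma colorableU A B k l :
  colorable A k -> colorable B l -> colorable (A :|: B) (k + l).
Proof.
move=> [c ck ce] [d dl de].
exists (fun x => if x \in A then c x else k + d x) => [x|x y].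
  rewrite inE; case: ifP => [Ax _|_ /=]; first exact: ltn_addr (ck x Ax).
  by rewrite ltn_add2l => /dl.
rewrite !inE; case: ifP => [Ax _|_ /= Bx]; case: ifP => [Ay _|_ /= By] exy.
- exact: ce.
- by rewrite ltn_eqF // ltn_addr // ck.
- by rewrite gtn_eqF // ltn_addr // ck.
- by rewrite eqn_add2l de.
Qed.

(** On each fibre the merged map uses the colouring chosen for one representative [rep x], which
    depends only on [h x]. Edges between fibres stay uncontrolled. *)
Lemma colorable_fibres (T : eqType) (h : V -> T) A k :
  (forall t, colorable [set x in A | h x == t] k) ->
  exists2 c : V -> nat, (forall x, x \in A -> c x < k) &
    forall x y, x \in A -> y \in A -> h x = h y -> e x y -> c x != c y.
Proof.
move=> colT; pose F v := [set x in A | h x == h v].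
have [c cP] : exists c : V -> V -> nat, forall v,
    (forall x, x \in F v -> c v x < k) /\
    (forall x y, x \in F v -> y \in F v -> e x y -> c v x != c v y).
  apply: (@fin_all_exists _ (fun=> V -> nat) (fun v c =>
    (forall x, x \in F v -> c x < k) /\
    (forall x y, x \in F v -> y \in F v -> e x y -> c x != c y))) => v.
  by have [c c1 c2] := colT (h v); exists c.
pose rep x := odflt x [pick z | h z == h x].
have hrep x : h (rep x) = h x.
  by rewrite /rep; case: pickP => [z /eqP//|/(_ x)]; rewrite eqxx.
have eq_rep x y : h x = h y -> rep x = rep y.
  move=> hxy; have : rep x = odflt x [pick z | h z == h y] by rewrite -hxy.
  by move=> ->; rewrite /rep; case: pickP => [//|/(_ y)]; rewrite eqxx.
exists (fun x => c (rep x) x) => [x Ax|x y Ax Ay hxy exy].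
  by have [+ _] := cP (rep x); apply; rewrite inE Ax hrep /=.
have [_] := cP (rep y); rewrite (eq_rep _ _ hxy); apply => //.
  by rewrite inE Ax hrep hxy /=.
by rewrite inE Ay hrep /=.
Qed.

Lemma colorable_glue (T : eqType) (h : V -> T) A k :
  (forall x y, x \in A -> y \in A -> e x y -> h x = h y) ->
  (forall t, colorable [set x in A | h x == t] k) -> colorable A k.
Proof.
move=> eh /colorable_fibres[c ck ce]; exists c => // x y Ax Ay exy.
by apply: ce => //; apply: eh.
Qed.

(** The pair of [h x] and a colour within the fibre, encoded in base [k], is a proper colour. A
    partition into [m] classes thus costs a factor [m]. *)
Lemma colorable_prod (h : V -> nat) A m k : (forall x, x \in A -> h x < m) ->
  (forall i, colorable [set x in A | h x == i] k) -> colorable A (m * k).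
Proof.
move=> hm /colorable_fibres[c ck ce].
exists (fun x => h x * k + c x) => [x Ax|x y Ax Ay exy].
  apply: (@leq_trans ((h x).+1 * k)); first by rewrite mulSnr ltn_add2l ck.
  by rewrite leq_mul2r hm // orbT.
apply/eqP => eq_c; have k0 : 0 < k := leq_ltn_trans (leq0n _) (ck x Ax).
have /= := congr1 (divn^~ k) eq_c.
rewrite !divnMDl // !divn_small ?addn0 ?ck // => hxy.
have /= := congr1 (modn^~ k) eq_c; rewrite !modnMDl !modn_small ?ck //.
by apply/eqP; apply: ce.
Qed.

End Colouring.

(** * Induced paths *)

Section InducedPaths.

Variables (V : finType) (e : rel V).

(** Each vertex sees its successor and no later vertex; for symmetric [e] this is an induced
    path. *)
Fixpoint ipath (s : seq V) : bool :=
  if s is x :: s' then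
    [&& if s' is y :: t then e x y && all (predC (e x)) t else true,
        x \notin s' & ipath s']
  else true.

Lemma ipath_uniq s : ipath s -> uniq s.
Proof. by elim: s => //= x s IH /and3P[_ -> /IH]. Qed.

Lemma ipath_path x s : ipath (x :: s) -> path e x s.
Proof. by elim: s x => //= y s IH x /and3P[/andP[-> _] _ /IH]. Qed.

Lemma ipath_nth x0 s i j : ipath s -> i < j < size s ->
  e (nth x0 s i) (nth x0 s j) = (j == i.+1).
Proof.
elim: s i j => [|x s IH] [|i] [|j] //=; first by rewrite ltn0 andbF.
  case: s {IH} => [|y t]; rewrite ?ltn0 //= => /andP[/andP[exy xt] _].
  case: j => [_|j]; first by rewrite exy.
  by rewrite !ltnS => /(mem_nth x0)/(allP xt)/negPf.
by case/and3P=> _ _ /IH{}IH; rewrite !ltnS => /IH->.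
Qed.

Lemma ipath_cat q1 b q2 : ipath (rcons q1 b) -> ipath (b :: q2) ->
    (forall x y, x \in q1 -> y \in q2 -> ~~ e x y && (x != y)) ->
  ipath (q1 ++ b :: q2).
Proof.
elim: q1 => // x q1 IH /= /and3P[xq xb q1b] bq2 anti.
have {IH} /= -> := IH q1b bq2 (fun y z yq => anti y z (mem_behead (s := x :: q1) yq)).
have xq2 y : y \in q2 -> ~~ e x y && (x != y) by apply: anti; rewrite mem_head.
rewrite mem_cat inE !negb_or andbT; rewrite mem_rcons inE negb_or in xb.
case/andP: xb => -> ->; rewrite andTb andTb.
have -> : x \notin q2 by apply/negP => /xq2; rewrite eqxx andbF.
case: q1 xq {anti q1b} => [|y t] /= /andP[-> xt]; rewrite andbT.
  by apply/allP => z /xq2/andP[].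
rewrite -cats1 all_cat /= andbT in xt; case/andP: xt => xt xb.
by rewrite all_cat xt /= xb; apply/allP => z /xq2/andP[].
Qed.

Lemma ipath_consP x s : ipath (x :: s) ->
  [/\ ipath s, x \notin s & forall z, z \in s -> e x z = (z == head x s)].
Proof.
move=> /= /and3P[xs x_s ips]; split=> //; case: s xs x_s ips => // y t.
move=> /= /andP[exy xt] _ /and3P[_ yt _] z; rewrite inE => /predU1P[->|zt].
  by rewrite exy eqxx.
by rewrite (negPf (allP xt z zt)); apply/esym/negP => /eqP eq_zy; rewrite -eq_zy zt in yt.
Qed.

Lemma ipath_rconsP s x : ipath (rcons s x) ->
  [/\ ipath s, x \notin s & forall z, z \in s -> e z x = (z == last x s)].
Proof.
elim: s => // y [_|w t IH].
  move=> /= /and3P[/andP[eyx _] + _]; rewrite !inE => nyx; split=> // [|z].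
    by rewrite ?inE eq_sym.
  by rewrite inE => /eqP->; rewrite eyx eqxx.
rewrite !rcons_cons => /and3P[/andP[eyw]]; rewrite all_rcons => /andP[/= eyx eyt].
rewrite -rcons_cons mem_rcons inE negb_or => /andP[nyx ywt] /IH[ipwt xwt ex].
split=> [||z].
- by apply/and3P; rewrite eyw eyt.
- by rewrite inE negb_or eq_sym nyx.
rewrite inE => /predU1P[->|/ex->//]; rewrite (negPf eyx) /=.
by apply/esym/negP => /eqP eq_y; rewrite eq_y mem_last in ywt.
Qed.

Lemma ipath_ends a q b : ipath (a :: rcons q b) -> q != [::] -> e a b = false.
Proof.
move=> ipq q0; have [ipqb aqb ->] := ipath_consP ipq; last by rewrite mem_rcons mem_head.
have [_ bq _] := ipath_rconsP ipqb.
by case: q q0 bq {ipq ipqb aqb} => //= x q _; rewrite inE negb_or => /andP[/negPf].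
Qed.

(* Shortcut at the last vertex of the path that [x] equals or sees. *)
Lemma ipath_shortcut x q : q != [::] -> ipath q ->
    has (fun z => e x z || (z == x)) q ->
  exists q', [/\ ipath (x :: q'), last x q' = last x q & {subset q' <= q}].
Proof.
elim: q => // y q IH _ /= /and3P[yq y_q ipq].
have [hasq _|/hasPn noq] := boolP (has (fun z => e x z || (z == x)) q).
  have q0 : q != [::] by case: (q) hasq.
  have [q' [ipq' lastq' sq']] := IH q0 ipq hasq; exists q'; split=> //.
    by rewrite lastq' /=; case: (q) q0.
  by move=> z /sq'; rewrite inE orbC => ->.
have xq : x \notin q by apply/negP => /noq; rewrite eqxx orbT.
have [eq_yx _|nyx] := eqVneq y x.
  exists q; split; [|by rewrite eq_yx|by move=> z; rewrite inE orbC => ->].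
  by rewrite /= -eq_yx yq y_q ipq.
rewrite !orbF => exy; exists (y :: q); split=> //=.
rewrite yq y_q ipq !andbT inE negb_or eq_sym nyx xq exy /= andbT.
by apply/allP => z /noq; rewrite negb_or => /andP[].
Qed.

Definition restr (S : {set V}) : rel V := [rel x y | [&& x \in S, y \in S & e x y]].

Lemma restr_sym S : symmetric e -> symmetric (restr S).
Proof. by move=> esym x y; rewrite /restr /= andbCA esym. Qed.

Lemma connect_restrS (S S' : {set V}) x y : S \subset S' ->
  connect (restr S) x y -> connect (restr S') x y.
Proof.
move=> /subsetP sS; apply: connect_sub => u v /and3P[uS vS uv].
by apply: connect1; rewrite /restr /= !sS.
Qed.

Lemma connect_restr_mem (S : {set V}) x y :
  x \in S -> connect (restr S) x y -> y \in S.
Proof.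
move=> xS /connectP[p + ->]; elim: p x xS => //= z p IH x xS.
by case/andP=> /and3P[_ zS _]; apply: IH.
Qed.

(** Induction along a walk: [x] is put before the induced path from the next vertex, and
    [ipath_shortcut] drops what precedes the last vertex that [x] equals or sees. *)
Lemma connect_ipath (S : {set V}) x y : x \in S -> connect (restr S) x y ->
  exists q, [/\ ipath (x :: q), last x q = y & {subset x :: q <= S}].
Proof.
move=> xS /connectP[p + ->]; elim: p x xS => [|z p IH] x xS /=.
  by exists [::]; split=> // u; rewrite inE => /eqP->.
case/andP=> /and3P[_ zS exz] /(IH z zS)[q [ipq lastq sq]].
have [//||q' [ipq' lastq' sq']] := @ipath_shortcut x (z :: q) _ ipq.
  by rewrite /= exz.
exists q'; split; rewrite ?lastq' // => u; rewrite inE => /predU1P[->//|].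
by move=> /sq'/sq.
Qed.

End InducedPaths.

(** * Holes and their orientations *)

Section Holes.

Variables (V : finType) (adj : rel V).
Hypothesis (adjP : digraph adj).
Let e := und adj.

Lemma und_sym : symmetric (und adj).
Proof. by move=> x y; rewrite /und orbC. Qed.

Lemma und_irr : irreflexive (und adj).
Proof. by move=> x; apply/negP; rewrite /und orbb => xx; have := adjP xx; rewrite xx. Qed.

Lemma hole_cons x q : ipath e q -> x \notin q -> 3 <= size q ->
    (forall z, z \in q -> e x z = (z == head x q) || (z == last x q)) ->
  hole adj (x :: q).
Proof.
move=> ipq xq sq3 ex; have uq := ipath_uniq ipq.
split=> [||x0 i j]; rewrite /= ?xq //.
set n := (size q).+1; rewrite !ltnS -/e.
have modE m : m <= n -> m %% n = if m == n then 0 else m.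
  by rewrite leq_eqVlt => /predU1P[->|lt_mn]; rewrite ?eqxx ?modnn // ltn_eqF ?modn_small.
have q_gt0 : 0 < size q by apply: leq_trans sq3.
have head_q : head x q = nth x0 q 0 by case: (q) q_gt0.
have last_q : last x q = nth x0 q (size q).-1.
  by rewrite (last_nth x0) -[in LHS](prednK q_gt0).
have xE k : k < size q -> e x (nth x0 q k) = (k == 0) || (k == (size q).-1).
  move=> kq; rewrite ex ?mem_nth // head_q last_q !nth_uniq //.
  by rewrite prednK.
have n_gt1 : 1 < n by rewrite /n ltnS.
have sizeE k : k < size q -> (k.+2 == n) = (k == (size q).-1).
  by move=> kq; rewrite /n eqSS -{1}(prednK q_gt0) eqSS.
case: i j => [|i] [|j] iq jq /=; rewrite ?(modn_small n_gt1).
- by rewrite /e und_irr.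
- rewrite xE // modE /n ?ltnS // -/n sizeE // eqSS.
  by case: (j == (size q).-1).
- rewrite /e und_sym -/e xE // modE /n ?ltnS // -/n sizeE // eqSS orbC.
  by case: (i == (size q).-1).
rewrite !modE /n ?ltnS // -/n !sizeE //.
have eqE a b : a < size q -> b < size q ->
    (b.+1 == (if a == (size q).-1 then 0 else a.+2)) = (b == a.+1).
  move=> aq bq; case: (a =P (size q).-1) => [->|_]; last by rewrite eqSS.
  by rewrite prednK // [RHS]ltn_eqF.
rewrite !eqE //; case: (ltngtP i j) => [ij|ji|->].
- by rewrite ipath_nth ?ij // [X in _ || X]ltn_eqF ?orbF // ltnW.
- by rewrite /e und_sym -/e ipath_nth ?ji // [X in X || _]ltn_eqF // ltnW.
- by rewrite /e und_irr -/e ltn_eqF.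
Qed.

(** Adjacency on a hole is a shift of the index by one modulo the length, and this shift is
    injective, so [b] has at most two neighbours there. *)
Lemma hole_nbrs s a b c u : hole adj s ->
    a \in s -> b \in s -> c \in s -> u \in s -> a != c ->
    e b a -> e b c -> e b u -> (u == a) || (u == c).
Proof.
move=> [us _ holeP] as_ bs cs us_.
have nbE v w : v \in s -> w \in s -> e v w =
    (index w s == (index v s).+1 %% size s) || (index v s == (index w s).+1 %% size s).
  by move=> vs ws; rewrite -(holeP v) ?index_mem // !nth_index.
have eqE v w : v \in s -> w \in s -> (v == w) = (index v s == index w s).
  by move=> vs ws; rewrite -(nth_uniq v _ _ us) ?index_mem // !nth_index.
rewrite !eqE // !nbE // {nbE eqE}.
move: (index a s) (index b s) (index c s) (index u s)
  (index_mem a s) (index_mem b s) (index_mem c s) (index_mem u s).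
rewrite as_ bs cs us_ => i j k l il jl kl ll.
have inj x y : x < size s -> y < size s -> j == x.+1 %% size s ->
    j == y.+1 %% size s -> x = y.
  move=> xs ys /eqP-> /eqP; rewrite -[x.+1]addn1 -[y.+1]addn1.
  by move/eqP; rewrite eqn_modDr !modn_small // => /eqP.
move=> ik; case/orP=> [/eqP ij|ij]; case/orP=> [/eqP kj|kj];
  case/orP=> [/eqP lj|lj]; move: ik.
- by rewrite ij kj eqxx.
- by rewrite ij kj eqxx.
- by rewrite lj ij eqxx.
- by rewrite (inj l k) ?eqxx ?orbT.
- by rewrite lj kj eqxx orbT.
- by rewrite (inj l i) ?eqxx.
- by rewrite (inj i k) ?eqxx.
- by rewrite (inj i k) ?eqxx.
Qed.

(* Keeping the direction as a parameter covers a configuration and its reversal at once. *)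
Definition darc (d : bool) x y := if d then adj x y else adj y x.

Lemma darcN d x y : darc (~~ d) x y = darc d y x.
Proof. by case: d. Qed.

Lemma darcF d x y : darc d x y -> darc d y x = false.
Proof. by case: d => /adjP/negPf. Qed.

Lemma outdeg_hole s a b c : hole adj s -> a \in s -> b \in s -> c \in s ->
  a != c -> e b a -> e b c -> outdeg_in adj s b = adj b a + adj b c.
Proof.
move=> hs as_ bs cs ac ba bc; rewrite /outdeg_in.
have -> : [set u | (u \in s) && adj b u] =
    (if adj b a then [set a] else set0) :|: (if adj b c then [set c] else set0).
  apply/setP => u; rewrite !inE; apply/andP/idP => [[us bu]|].
    have /orP[/eqP eq_u|/eqP eq_u] : (u == a) || (u == c).
    - by apply: (hole_nbrs hs as_ bs cs us ac); rewrite /e /und ?bu.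
    - by rewrite -eq_u bu inE eqxx.
    - by rewrite -eq_u bu inE eqxx orbT.
  case/orP; [case: ifP => abu|case: ifP => abu]; rewrite ?inE // => /eqP->;
    by split.
by case: ifP; case: ifP; rewrite ?setU0 ?set0U ?cards0 ?cards1 // cards2 ac.
Qed.

Section Step.
Variables (s : seq V) (d : bool) (a b c : V).
Hypotheses (hs : hole adj s) (as_ : a \in s) (bs : b \in s) (cs : c \in s).
Hypotheses (ac : a != c) (eab : e a b) (ebc : e b c).

(** Exactly one of the two hole edges at [b] leaves it, so the direction carries on. *)
Lemma directed_step : directed_hole adj s -> darc d a b -> darc d b c.
Proof.
move=> /(_ b bs); rewrite (outdeg_hole hs as_ bs cs ac) //; last by rewrite /e und_sym.
move=> deg ab; move: deg ab; have:= @adjP a b; have := @adjP b a; have:= @adjP b c.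
by move: ebc; rewrite /e /und /darc; case: d; do 4?[case: (adj _ _)] => //=.
Qed.

(** The two hole edges at [b] both leave it or both enter it, so the direction flips. *)
Lemma alternating_step : alternating_hole adj s -> darc d a b -> darc d c b.
Proof.
move=> /(_ b bs); rewrite (outdeg_hole hs as_ bs cs ac) //; last by rewrite /e und_sym.
move=> deg ab; move: deg ab; have:= @adjP a b; have := @adjP b a; have:= @adjP b c.
by move: ebc; rewrite /e /und /darc; case: d; do 4?[case: (adj _ _)] => //= *; intuition.
Qed.

End Step.

Lemma directed_path s d a b t : hole adj s -> directed_hole adj s ->
  uniq [:: a, b & t] -> {subset [:: a, b & t] <= s} -> path e a (b :: t) ->
  darc d a b -> path (darc d) a (b :: t).
Proof.
move=> hs dir; elim: t a b => [|c t IH] a b us sub /=; first by move=> _ ->.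
case/and3P=> eab ebc pct ab; rewrite ab /=.
have mem x : x \in [:: a, b, c & t] -> x \in s by apply: sub.
apply: (IH b c).
- by case/andP: us.
- by move=> x xt; apply: sub; rewrite inE xt orbT.
- by rewrite /= ebc.
apply: (directed_step hs _ _ _ _ eab ebc dir ab); rewrite ?mem ?inE ?eqxx ?orbT //.
by apply: contraTneq us => ->; rewrite /= !inE eqxx orbT.
Qed.

(** An induced path from [b] to [a] inside [S] completes the hole, since [q] avoids [S] and sees
    only the ends there. The last two conclusions serve to identify the vertices next to [a] and [b]
    on the hole. *)
Lemma close_path a q b (S : {set V}) :
    ipath e (a :: rcons q b) -> q != [::] -> a \in S -> b \in S ->
    connect (restr e S) b a -> (forall z, z \in q -> z \notin S) ->
    (forall z x, z \in q -> x \in S -> e z x -> (x == a) || (x == b)) ->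
  exists s, [/\ hole adj s, {subset a :: rcons q b <= s},
    exists2 x, x \in S & (x \in s) && e a x &
    exists2 x, x \in S & (x \in s) && e b x].
Proof.
move=> ipq q0 aS bS conn qS anti.
have [ipqb aqb ea] := ipath_consP ipq.
have head_qb : head a (rcons q b) = head a q by case: (q) q0.
have {aqb}[nab aq] : a != b /\ a \notin q.
  by move: aqb; rewrite mem_rcons inE negb_or => /andP[].
have [_ bq _] := ipath_rconsP ipqb.
have hq : head a q \in q by case: (q) q0 => //= x t _; rewrite mem_head.
have neq_hq x : x \in S -> (x == head a q) = false.
  by move=> xS; apply: contraTF xS => /eqP->; apply: qS.
have eabF : e a b = false := ipath_ends ipq q0.
have [p [ipp lastp sp]] := connect_ipath bS conn.
(* The path inside [S] is [b], then [r], then [a]; here [r] is nonempty because [a] and [b] are not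
   adjacent. *)
case/lastP: p => [|r x] in ipp lastp sp *; first by rewrite -lastp eqxx in nab.
rewrite last_rcons in lastp; rewrite {x}lastp in ipp sp.
rewrite -rcons_cons in ipp; have [ipr ar er] := ipath_rconsP ipp.
have r0 : r != [::].
  by apply: contraFN eabF => /eqP r0; rewrite /e und_sym -/e er ?mem_head // r0.
have lastE : last a (b :: r) = last b r by [].
have br : b \notin r by case/ipath_consP: ipr.
have lr : last b r \in r by case: (r) r0 => //= x t _; rewrite mem_last.
have rS x : x \in r -> x \in S.
  by move=> xr; apply: sp; rewrite inE mem_rcons inE xr !orbT.
have ra x : x \in r -> x == a = false.
  by apply: contraTF => /eqP->; rewrite inE negb_or in ar; case/andP: ar.
have rb x : x \in r -> x == b = false.
  by apply: contraTF => /eqP->.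
have hole_s : hole adj (a :: (q ++ b :: r)).
  apply: hole_cons => //.
  - apply: ipath_cat => // x y xq yr; apply/andP; split.
      by apply/negP => exy; have := anti x y xq (rS y yr) exy; rewrite ra // rb.
    by apply: contraTneq (rS y yr) => <-; apply: qS.
  - by rewrite mem_cat negb_or aq.
  - by rewrite size_cat /= addnS ltnS (@leq_add 1 1) ?lt0n ?size_eq0.
  have -> : head a (q ++ b :: r) = head a q by case: (q) q0.
  rewrite last_cat /= => z; rewrite mem_cat inE => /or3P[zq|/eqP->|zr].
  - rewrite -/e ea ?mem_rcons ?inE ?zq ?orbT // head_qb.
    rewrite [X in _ || X](_ : _ = false) ?orbF //.
    by apply: contraTF (rS _ lr) => /eqP<-; apply: qS.
  - by rewrite -/e eabF neq_hq // eq_sym rb.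
  - by rewrite /e und_sym -/e er ?inE ?zr ?orbT // neq_hq // rS.
exists (a :: (q ++ b :: r)); split=> //.
- move=> x; rewrite !inE mem_cat mem_rcons !inE.
  by case/or3P=> ->; rewrite ?orbT.
- exists (last b r); first exact: rS.
  by rewrite inE mem_cat inE lr !orbT /e und_sym -/e er ?inE ?lr ?orbT //= ?eqxx.
exists (head b r).
  by apply: rS; case: (r) r0 => // x t _; rewrite mem_head.
have hr : head b r \in r by case: (r) r0 => // x t _; rewrite mem_head.
rewrite inE mem_cat inE hr !orbT /=.
by case/ipath_consP: ipr => _ _ ->.
Qed.

End Holes.

(** Taking the first candidate in the enumeration makes choices comparable: nothing that precedes
    [f y] satisfies [P] at [y]. *)
Lemma first_choice (V : finType) (P : V -> V -> bool) : exists f : V -> V,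
  forall x y, P x y -> P (f y) y /\ enum_rank (f y) <= enum_rank x.
Proof.
exists (fun y => if [pick x | P x y] is Some x0
                 then [arg min_(x < x0 | P x y) enum_rank x] else y).
move=> x y Pxy; case: pickP => [x0 Px0|/(_ x)]; last by rewrite Pxy.
by case: arg_minnP => // z Pz minz; split=> //; apply: minz.
Qed.

(** * Breadth-first levels *)

Section Levels.

Variables (V : finType) (adj : rel V).
Local Notation e := (und adj).

Definition ball r n :=
  iter n (fun A : {set V} => A :|: [set y | [exists x in A, e x y]]) [set r].
Arguments ball : simpl never.

(** These are the vertices at distance less than [n]. The empty value at 0 makes [level r n] the
    vertices at distance exactly [n], for 0 as well. *)
Definition below r n := if n is m.+1 then ball r m else set0.

Definition level r n := ball r n :\: below r n.

Lemma in_ballS r n y :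
  (y \in ball r n.+1) = (y \in ball r n) || [exists x in ball r n, e x y].
Proof. by rewrite in_setU inE. Qed.

Lemma ball_step r n x y : x \in ball r n -> e x y -> y \in ball r n.+1.
Proof.
move=> xb exy; rewrite in_ballS; apply/orP; right.
by apply/existsP; exists x; rewrite xb.
Qed.

Lemma ball0 r : r \in ball r 0.
Proof. by rewrite inE. Qed.

Lemma ballS r n : ball r n \subset ball r n.+1.
Proof. by apply/subsetP => x xb; rewrite in_ballS xb. Qed.

Lemma below_step r n x y : x \in below r n -> e x y -> y \in below r n.+1.
Proof. by case: n => [|n]; [rewrite inE | apply: ball_step]. Qed.

Lemma belowS r m n : m <= n -> below r m \subset below r n.
Proof.
elim: n => [|n IH]; first by rewrite leqn0 => /eqP->.
rewrite leq_eqVlt => /predU1P[->//|/IH/subset_trans]; apply.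
by case: n {IH} => [|n]; rewrite ?sub0set // ballS.
Qed.

Lemma level_below r n x : x \in level r n -> x \in below r n.+1.
Proof. by rewrite inE => /andP[]. Qed.

Lemma level_notin r m n x : m <= n -> x \in level r n -> x \notin below r m.
Proof.
by move=> le_mn; rewrite inE => /andP[+ _]; apply/contra/subsetP/belowS.
Qed.

Lemma level_neq r m n x y : m < n -> x \in level r m -> y \in level r n -> x != y.
Proof.
move=> lt_mn /level_below xm /(level_notin lt_mn).
by apply: contraNneq => <-.
Qed.

Lemma level_sep r m n x y : m < n -> x \in below r m -> y \in level r n -> e x y = false.
Proof.
move=> lt_mn xm /(level_notin lt_mn); apply: contraNF.
exact: below_step.
Qed.

Lemma level_parent r n x : x \in level r n.+1 -> exists2 y, y \in level r n & e y x.
Proof.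
rewrite in_setD in_ballS /= => /andP[nx]; rewrite (negPf nx) /=.
case/existsP => y /andP[yb eyx]; exists y => //; rewrite in_setD yb andbT.
by apply: contra nx => /below_step/(_ eyx).
Qed.

Lemma level0 r : level r 0 = [set r].
Proof. by rewrite /level /= setD0. Qed.

Lemma ball_levelU r n : ball r n.+1 = ball r n :|: level r n.+1.
Proof.
apply/setP => x; rewrite in_setU in_setD /=.
by case: (boolP (x \in ball r n)) => // /(subsetP (ballS r n)).
Qed.

(** Parents are followed down to the root. Two vertices of a level are thus joined through earlier
    levels, which is how paths are closed to holes. *)
Lemma level_connect r n x (S : {set V}) : x \in level r n -> x \in S ->
  below r n \subset S -> connect (restr e S) x r.
Proof.
elim: n x => [|n IH] x; first by rewrite level0 inE => /eqP->.
case/level_parent=> y yn eyx xS sS.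
have yS : y \in S by rewrite (subsetP sS) // level_below.
apply: connect_trans (connect1 _) (IH y yn yS _).
  by rewrite /restr /= xS yS und_sym.
exact: subset_trans (belowS r (leqnSn n)) sS.
Qed.

Lemma ex_level r x : connect e r x -> exists n, x \in level r n.
Proof.
move=> /connectP[p ep eq_x].
have xb : exists n, x \in ball r n.
  suff: forall y n, y \in ball r n -> path e y p -> exists n, last y p \in ball r n.
    by move=> /(_ r 0 (ball0 r) ep); rewrite -eq_x.
  elim: p {ep eq_x} => [|z p IH] y n yb /=; first by exists n.
  by move=> /andP[/(ball_step yb)/IH].
exists (ex_minn xb); case: ex_minnP => -[|n] xn minn; rewrite inE xn /= ?inE // andbT.
by apply/negP => /minn; rewrite ltnn.
Qed.

Lemma level_edge r m n x y : x \in level r m -> y \in level r n -> e x y -> n <= m.+1.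
Proof.
move=> xm yn exy; rewrite leqNgt; apply/negP => lt_mn.
by rewrite (level_sep lt_mn (level_below xm) yn) in exy.
Qed.

End Levels.

(** * Local structure when no long hole is disoriented *)

Section NoHole.

Variables (V : finType) (adj : rel V).
Hypothesis (adjP : digraph adj).
Local Notation e := (und adj).

Hypothesis no_hole : forall s, long_hole adj s -> ~ disoriented_hole adj s.

(** Otherwise [u x y w] closes through the earlier levels to a long hole. Along this path its outer
    edges point in opposite directions, whereas in a directed or an alternating hole the first and
    third edges of a path point the same way. *)
Lemma adjacent_parents r j d x y u w : x \in level adj r j.+1 -> y \in level adj r j.+1 ->
    u \in level adj r j -> w \in level adj r j -> e x y -> e u x -> e w y ->
    ~~ e u y -> ~~ e w x -> darc adj d u x -> darc adj d w y ->
  e u w.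
Proof.
move=> xl yl ul wl exy eux ewy nuy nwx aux awy; apply: contraT => nuw.
pose S := [set u; w] :|: below adj r j.
have nuw' : u != w by apply: contraNneq nuy => ->.
have lneq z t : z \in level adj r j -> t \in level adj r j.+1 -> z != t by apply: level_neq.
have nxy : x != y by apply: contraTneq exy => ->; rewrite und_irr.
have ip : ipath e (u :: rcons [:: x; y] w).
  rewrite /= eux exy (und_sym adj y) ewy (negPf nuy) (negPf nuw) (und_sym adj x) (negPf nwx).
  by rewrite !inE !negb_or nuw' nxy !(eq_sym _ w) !(lneq u, lneq w).
have uniqP := ipath_uniq ip.
have uS : u \in S by rewrite !inE eqxx.
have wS : w \in S by rewrite !inE eqxx orbT.
have conn : connect (restr e S) w u.
  apply: (@connect_trans _ _ r); first by apply: level_connect wl wS _; rewrite subsetUr.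
  rewrite (sym_connect_sym (restr_sym _ (und_sym adj))).
  by apply: level_connect ul uS _; rewrite subsetUr.
have xyl z : z \in [:: x; y] -> z \in level adj r j.+1.
  by rewrite mem_seq2 => /orP[] /eqP->.
have qS z : z \in [:: x; y] -> z \notin S.
  move=> /xyl zl; rewrite !inE !negb_or (level_notin (leqnSn j) zl) andbT.
  by rewrite !(eq_sym z) !(lneq u, lneq w).
have anti z t : z \in [:: x; y] -> t \in S -> e z t -> (t == u) || (t == w).
  move=> /xyl zl; rewrite !inE => /orP[//|tb].
  by rewrite und_sym (level_sep (ltnSn j) tb zl).
have [s [hs ss [t tS /andP[ts eut]] _]] := close_path adjP ip isT uS wS conn qS anti.
exfalso; apply: (no_hole (s := s)).
  (* The neighbour [t] of [u] in [S] is a fifth vertex, so the hole is long. *)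
  split=> //; have sz : size [:: t, u & rcons [:: x; y] w] = 5 by [].
  rewrite -sz; apply: uniq_leq_size => [|z]; last by rewrite inE => /predU1P[->|/ss].
  rewrite cons_uniq uniqP andbT !inE !negb_or.
  have tq z : z \in [:: x; y] -> t != z by move=> /qS; apply: contraNneq => <-.
  have [ntu ntw] : t != u /\ t != w.
    by split; apply: contraTneq eut => ->; rewrite ?und_irr.
  by rewrite ntu ntw !tq // mem_seq2 eqxx ?orbT.
have mem z : z \in [:: u; x; y; w] -> z \in s by apply: ss.
have [us xs ys ws] : [/\ u \in s, x \in s, y \in s & w \in s].
  by split; apply: mem; rewrite !inE eqxx ?orbT.
have nuyE : u != y by apply: lneq.
have nxw : x != w by rewrite eq_sym lneq.
have eyw : e y w by rewrite und_sym.
split=> [dir|alt].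
  have := directed_path adjP hs dir uniqP ss (ipath_path ip) aux.
  by case/and4P=> _ _ ayw _; rewrite (darcF adjP ayw) in awy.
have ayx := alternating_step adjP hs us xs ys nuyE eux exy alt aux.
rewrite -darcN in ayx.
have := alternating_step adjP hs xs ys ws nxw exy eyw alt ayx.
by rewrite darcN (darcF adjP awy).
Qed.

(* The hole is not directed because the two grandparent edges both point down, or both up. *)
Lemma close_grandparents r j d a ga q y gy :
    ipath e (a :: rcons q y) -> q != [::] ->
    a \in level adj r j.+1 -> y \in level adj r j.+1 ->
    ga \in level adj r j -> gy \in level adj r j -> e ga a -> e gy y ->
    ga != gy -> ~~ e gy a -> ~~ e ga y -> darc adj d ga a -> darc adj d gy y ->
    (forall z, z \in q -> [&& z \notin below adj r j.+1, ~~ e ga z & ~~ e gy z]) ->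
  exists s, [/\ hole adj s, {subset [:: ga, a & rcons q y] <= s} &
    ~ ~ alternating_hole adj s].
Proof.
move=> ip q0 al yl gal gyl ega egy nga ngya ngay aga agy qP.
(* Inside [S] the ends are joined through [ga], the root and [gy], while [q] sees nothing of [S] but
   [a] and [y]. *)
pose S := [set a; y; ga; gy] :|: below adj r j.
have aS : a \in S by rewrite !inE eqxx.
have yS : y \in S by rewrite !inE eqxx orbT.
have gaS : ga \in S by rewrite !inE eqxx !orbT.
have gyS : gy \in S by rewrite !inE eqxx !orbT.
have sS : below adj r j \subset S by rewrite subsetUr.
have rsym := sym_connect_sym (restr_sym S (und_sym adj)).
have conn : connect (restr e S) y a.
  apply: (@connect_trans _ _ r); last rewrite rsym.
    apply: connect_trans (level_connect gyl gyS sS).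
    by apply: connect1; rewrite /restr /= yS gyS und_sym.
  apply: connect_trans (level_connect gal gaS sS).
  by apply: connect1; rewrite /restr /= aS gaS und_sym.
have uq := ipath_uniq ip.
have qa z : z \in q -> (z == a = false) * (z == y = false).
  move=> zq; split; apply: contraTF uq => /eqP eq_z; rewrite -eq_z /=.
    by rewrite mem_rcons inE zq orbT.
  by rewrite rcons_uniq zq andbF.
have gbelow z : z \in level adj r j -> z \in below adj r j.+1 := @level_below _ _ _ _ _.
have qS z : z \in q -> z \notin S.
  move=> zq; have /and3P[zb _ _] := qP z zq; rewrite !inE !qa //= !negb_or.
  rewrite (contra (subsetP (belowS adj r (leqnSn j)) z) zb) andbT.
  by apply/andP; split; apply: contraNneq zb => ->; apply: gbelow.
have anti z t : z \in q -> t \in S -> e z t -> (t == a) || (t == y).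
  move=> zq; have /and3P[zb gaz gyz] := qP z zq; rewrite !inE -!orbA.
  case/or4P=> [->//|->//||]; first by rewrite orbT.
    by move=> /eqP->; rewrite und_sym (negPf gaz).
  case/orP=> [/eqP->|tb]; first by rewrite und_sym (negPf gyz).
  by rewrite und_sym => /(below_step tb); rewrite (negPf zb).
have eay := ipath_ends ip q0.
have [s [hs ss [t tS /andP[ts eat]] [t' tS' /andP[ts' eyt]]]] :=
  close_path adjP ip q0 aS yS conn qS anti.
have below_sep x z : x \in below adj r j -> z \in level adj r j.+1 -> e z x = false.
  by move=> xb zl; rewrite und_sym (level_sep (ltnSn j) xb zl).
(* In [S] the end [a] has no neighbour other than [ga], so the hole runs through [ga]; likewise for
   [y] and [gy]. *)
have gas : ga \in s.
  suff <- : t = ga by [].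
  move: tS eat; rewrite !inE -!orbA; case/or4P=> [/eqP->|/eqP->|/eqP->//|].
  - by rewrite und_irr.
  - by rewrite eay.
  by case/orP=> [/eqP->|/below_sep->//]; rewrite und_sym (negPf ngya).
have gys : gy \in s.
  suff <- : t' = gy by [].
  move: tS' eyt; rewrite !inE -!orbA; case/or4P=> [/eqP->|/eqP->|/eqP->|].
  - by rewrite und_sym eay.
  - by rewrite und_irr.
  - by rewrite und_sym (negPf ngay).
  by case/orP=> [/eqP->//|/below_sep->].
have up z : z \in a :: rcons q y -> z \notin below adj r j.+1.
  rewrite inE mem_rcons inE => /or3P[/eqP->|/eqP->|/qP/and3P[]//];
    exact: level_notin (leqnn _) _.
have uqg : uniq [:: ga, a & rcons (rcons q y) gy].
  rewrite -rcons_cons -[_ :: rcons _ _]/(rcons (ga :: a :: rcons q y) gy) rcons_uniq.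
  rewrite cons_uniq uq andbT inE negb_or eq_sym nga.
  by apply/andP; split; apply/negP => /up; rewrite gbelow.
have sub : {subset [:: ga, a & rcons (rcons q y) gy] <= s}.
  move=> z; rewrite !inE mem_rcons inE => /or4P[/eqP->//|/eqP->|/eqP->//|zq].
    by apply: ss; rewrite mem_head.
  by apply: ss; rewrite inE zq orbT.
exists s; split=> // [z|nalt].
  by rewrite inE => /predU1P[->|/ss].
apply: (no_hole (s := s)); first split=> //.
  apply: (@leq_trans (size [:: ga, a & rcons (rcons q y) gy])); last exact: uniq_leq_size.
  by rewrite /= !size_rcons !ltnS lt0n size_eq0.
split=> // dir.
have := directed_path adjP hs dir uqg sub _ aga.
rewrite /= ega /= rcons_path (ipath_path ip) last_rcons und_sym egy => /(_ isT).
by rewrite rcons_path last_rcons => /and3P[_ _ ayg]; rewrite (darcF adjP ayg) in agy.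
Qed.

(* The induced paths [gw w ..] and [gu u w ..] have a common tail from [w] on, and both can be
   closed to long holes that are not directed; as their lengths differ by one, they cannot both
   alternate. *)
Lemma no_two_tails r j d (X : {set V}) u w gu gw x z y gy :
    (forall t, t \in X -> t \in level adj r j.+2) ->
    u \in level adj r j.+1 -> w \in level adj r j.+1 -> y \in level adj r j.+1 ->
    gu \in level adj r j -> gw \in level adj r j -> gy \in level adj r j ->
    e gu u -> e gw w -> e gy y -> e u w -> ~~ e gu w ->
    darc adj d gu u -> darc adj d gw w -> darc adj d gy y ->
    (forall t, t \in X -> ~~ e u t) ->
    x \in X -> z \in X -> connect (restr e X) x z -> e w x -> e y z ->
    z \notin ball adj w 4 -> False.
Proof.
move=> Xl ul wl yl gul gwl gyl egu egw egy euw nguw agu agw agy uX xX zX conn ewx eyz zfar.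
have far n s t : e s t -> t \notin ball adj w n.+1 -> s \notin ball adj w n.
  by move=> est; apply: contra => /ball_step; apply.
have near n s t : e s t -> s \in ball adj w n -> t \in ball adj w n.+1.
  by move=> est /ball_step; apply.
(* As [z] is beyond distance 4 of [w], [y] is beyond 3 and [gy] beyond 2, while [gu] is within 2.
   This is just enough to separate the two ends. *)
have yfar : y \notin ball adj w 3 := far _ _ _ eyz zfar.
have gyfar : gy \notin ball adj w 2 := far _ _ _ egy yfar.
have w0 : w \in ball adj w 0 by apply: ball0.
have u1 : u \in ball adj w 1 by apply: near w0; rewrite und_sym.
have gu2 : gu \in ball adj w 2 by apply: near u1; rewrite und_sym.
have gw1 : gw \in ball adj w 1 by apply: near w0; rewrite und_sym.
have mono m n t : m <= n -> t \in ball adj w m -> t \in ball adj w n.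
  by move=> le_mn; apply/subsetP/(@belowS _ _ w m.+1 n.+1).
have neq_far m n s t : m <= n -> s \in ball adj w m -> t \notin ball adj w n -> s != t.
  by move=> le_mn sm; apply: contraNneq => <-; apply: mono sm.
have nadj_far m n s t : m < n -> s \in ball adj w m -> t \notin ball adj w n -> ~~ e s t.
  by move=> lt_mn sm; apply: contra => est; apply: mono lt_mn _; apply: near est sm.
have nadj_far' m n s t : m < n -> s \in ball adj w m -> t \notin ball adj w n -> ~~ e t s.
  by rewrite und_sym; apply: nadj_far.
have Xb t : t \in X -> t \notin below adj r j.+1.
  by move=> /Xl; apply: level_notin.
have sepX g t : g \in level adj r j -> t \in X -> ~~ e g t.
  by move=> /level_below gl /Xl tl; rewrite (level_sep (ltnSn _) gl tl).
have neX g t : g \in level adj r j.+1 -> t \in X -> g != t.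
  by move=> gl /Xl; apply: level_neq gl.
have nwy : w != y by apply: neq_far w0 yfar.
have ewy : e w y = false by apply/negbTE/(nadj_far 0 3).
have [q [ipq lastq sq]] : exists q, [/\ ipath e (w :: q), last w q = y &
    {subset w :: q <= [set w; y] :|: X}].
  apply: connect_ipath; first by rewrite !inE eqxx.
  apply: (@connect_trans _ _ x).
    by apply: connect1; rewrite /restr /= !inE eqxx xX orbT.
  apply: (@connect_trans _ _ z).
    by apply: connect_restrS conn; rewrite subsetUr.
  by apply: connect1; rewrite /restr /= !inE eqxx zX !orbT /= und_sym.
case/lastP: q => [|q y'] in ipq lastq sq *; first by rewrite -lastq eqxx in nwy.
rewrite last_rcons in lastq; rewrite {y'}lastq in ipq sq.
have q0 : q != [::].
  by apply: contraFN ewy => /eqP q0; move: ipq; rewrite q0 /= => /and3P[/andP[]].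
have uq := ipath_uniq ipq.
have qX t : t \in q -> t \in X.
  move=> tq; have := sq t; rewrite !inE mem_rcons inE tq !orbT => /(_ isT).
  rewrite -orbA; case/or3P=> // /eqP eq_t; move: uq; rewrite -eq_t /=.
    by rewrite mem_rcons inE tq orbT.
  by rewrite rcons_uniq tq andbF.
have [s [hs ss nalt]] : exists s, [/\ hole adj s, {subset [:: gw, w & rcons q y] <= s} &
    ~ ~ alternating_hole adj s].
  apply: (close_grandparents ipq q0 wl yl gwl gyl egw egy _ _ _ agw agy).
  - by apply: neq_far gw1 gyfar.
  - by apply: (nadj_far' 0 2).
  - by apply: (nadj_far 1 3).
  - by move=> t /qX tX; rewrite Xb // !sepX.
(* The path stays induced with [u] in front, since [u] sees neither [X] nor [y]. *)
have ipuq : ipath e (u :: rcons (w :: q) y).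
  rewrite rcons_cons; apply/and3P; split=> //.
    rewrite euw all_rcons /= (nadj_far 1 3) //.
    by apply/allP => t /qX/uX.
  rewrite inE mem_rcons inE !negb_or; apply/and3P; split.
  - by apply: contraTneq euw => ->; rewrite und_irr.
  - exact: neq_far u1 yfar.
  - by apply/negP => /qX/(neX u u ul); rewrite eqxx.
have [s' [hs' ss' nalt']] : exists s, [/\ hole adj s,
    {subset [:: gu, u & rcons (w :: q) y] <= s} & ~ ~ alternating_hole adj s].
  apply: (close_grandparents ipuq isT ul yl gul gyl egu egy _ _ _ agu agy).
  - by apply: neq_far gu2 gyfar.
  - by apply: (nadj_far' 1 2).
  - by apply: (nadj_far 2 3).
  - move=> t; rewrite inE => /predU1P[->|/qX tX]; last by rewrite Xb // !sepX.
    by rewrite (level_notin _ wl) // nguw (nadj_far' 0 2).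
case: q q0 ipq {sq uq} qX ss ipuq ss' => // p q _ ipq qX ss _ ss'.
have ewp : e w p by move: (ipath_path ipq) => /= /andP[].
have pX : p \in X by apply: qX; rewrite mem_head.
have pl := Xl p pX.
apply: nalt => alt; apply: nalt' => alt'.
have [gws ws ps] : [/\ gw \in s, w \in s & p \in s].
  by split; apply: ss; rewrite mem_head || rewrite inE mem_head orbT ||
     rewrite 2!inE mem_head !orbT.
have [gus us' ws' ps'] : [/\ gu \in s', u \in s', w \in s' & p \in s'].
  by split; apply: ss'; rewrite mem_head || rewrite inE mem_head orbT ||
     (rewrite 2!inE mem_head !orbT) || rewrite 3!inE mem_head !orbT.
have [ngwp nguw' nup] : [/\ gw != p, gu != w & u != p].
  by split; [apply: level_neq gwl pl|apply: level_neq gul wl|apply: level_neq ul pl].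
(* In the first hole [w p] is one edge after [gw w], in the second two edges after [gu u].
   Alternation therefore gives it opposite directions. *)
have apw : darc adj d p w.
  exact: (alternating_step adjP hs gws ws ps ngwp egw ewp alt agw).
have awu : darc adj (~~ d) u w.
  rewrite darcN.
  exact: (alternating_step adjP hs' gus us' ws' nguw' egu euw alt' agu).
have := alternating_step adjP hs' us' ws' ps' nup euw ewp alt' awu.
by rewrite darcN (darcF adjP apw).
Qed.

(** * Colouring levels and balls, given the induction hypothesis on the clique number *)

Variables (kappa tau : nat).

Hypothesis small_colorable : forall B : {set V},
  (forall S : {set V}, S \subset B -> cliqueb adj S -> #|S| <= kappa) -> colorable e B tau.

Hypothesis small_cliques : forall S : {set V}, cliqueb adj S -> #|S| <= kappa.+1.

(* A clique in [B] is extended by the vertex [f] assigns to its member of largest rank. *)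
Lemma colorable_nested (B : {set V}) (f : V -> V) (rk : V -> nat) :
    (forall x, x \in B -> e x (f x)) ->
    (forall x y, x \in B -> y \in B -> e x y -> rk x <= rk y -> e x (f y)) ->
  colorable e B tau.
Proof.
move=> fP nested; apply: small_colorable => S /subsetP SB clS.
have [->|[x0 x0S]] := set_0Vmem S; first by rewrite cards0.
have [m mS maxm] := arg_maxnP rk x0S.
have efm x : x \in S -> e x (f m).
  move=> xS; have [->|nxm] := eqVneq x m; first exact/fP/SB.
  apply: nested; rewrite ?SB //; last exact: maxm.
  by move/forall_inP: clS => /(_ x xS)/forall_inP/(_ m mS)/implyP; apply.
have fmS : f m \notin S.
  by apply/negP => /efm; rewrite und_irr.
rewrite -ltnS -[_.+1]add1n -[1]/(nat_of_bool true) -fmS -cardsU1.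
apply: small_cliques; apply/forall_inP => x; rewrite !inE => xS.
apply/forall_inP => y; rewrite !inE => yS; apply/implyP.
case/predU1P: xS => [->|xS]; case/predU1P: yS => [->|yS].
- by rewrite eqxx.
- by rewrite und_sym => _; apply: efm.
- by move=> _; apply: efm.
- by move/forall_inP: clS => /(_ x xS)/forall_inP/(_ y yS)/implyP.
Qed.

Lemma colorable_nbrs (B : {set V}) x : (forall y, y \in B -> e x y) -> colorable e B tau.
Proof.
move=> xB; apply: (@colorable_nested _ (fun=> x) (fun=> 0)) => [y yB|y z yB _ _ _];
  by rewrite und_sym xB.
Qed.

(** Sorting by the colour of the first parent makes first parents in a class nonadjacent. The factor
    2 records the orientation of the parent edge and one [tau] separates vertices with a common
    first parent. By [adjacent_parents] the remaining edges are nested, whence the other [tau]. *)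
Lemma colorable_levelS r j k :
  colorable e (level adj r j) k -> colorable e (level adj r j.+1) (k * (2 * (tau * tau))).
Proof.
move=> [c ck ce].
have [f fP] := first_choice (fun x y => (x \in level adj r j) && e x y).
have fl y : y \in level adj r j.+1 -> (f y \in level adj r j) && e (f y) y.
  by case/level_parent=> x xl exy; have [] := fP x y; rewrite ?xl.
have [c' c'k c'e] : exists2 c : V -> nat, (forall x, x \in level adj r j.+1 -> c x < tau) &
    forall x y, x \in level adj r j.+1 -> y \in level adj r j.+1 ->
      f x = f y -> e x y -> c x != c y.
  apply: colorable_fibres => t; apply: (@colorable_nbrs _ t) => y; rewrite in_set.
  by case/andP=> /fl/andP[_ efy] /eqP<-.
apply: (@colorable_prod _ _ (fun x => c (f x))) => [x /fl/andP[/ck]//|i].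
apply: (@colorable_prod _ _ (fun x => nat_of_bool (adj (f x) x))) => [x _|a].
  by case: (adj _ _).
apply: (@colorable_prod _ _ c') => [x|k'].
  by case/setIdP=> /setIdP[/c'k].
apply: (@colorable_nested _ f (fun x => enum_rank (f x))) => x.
  by rewrite und_sym => /setIdP[/setIdP[/setIdP[/fl/andP[]]]].
move=> y /setIdP[/setIdP[/setIdP[xl /eqP cx] /eqP ax] /eqP c'x].
move=> /setIdP[/setIdP[/setIdP[yl /eqP cy] /eqP ay] /eqP c'y] exy.
have [/andP[fxl efx] /andP[fyl efy]] := (fl x xl, fl y yl).
rewrite leq_eqVlt => /predU1P[/val_inj/enum_rank_inj eqf|ltf].
  by have := c'e x y xl yl eqf exy; rewrite c'x c'y eqxx.
(* If [f x] were also a parent of [y], the first parent of [y] would not come after it. *)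
apply: contraT => nfx; have nfy : ~~ e (f x) y.
  apply/negP => efxy; have [] := fP (f x) y; first by rewrite fxl.
  by rewrite leqNgt ltf.
have dar z : e (f z) z -> darc adj (adj (f z) z) (f z) z.
  by rewrite /darc /und; case: (adj (f z) z).
have eqa : adj (f x) x = adj (f y) y.
  by move: ax; rewrite -ay; do 2!case: (adj _ _).
have eff : e (f x) (f y).
  apply: (adjacent_parents xl yl fxl fyl exy efx efy nfy _ (dar x efx)).
    by rewrite und_sym.
  by rewrite eqa; apply: dar.
by have := ce _ _ fxl fyl eff; rewrite cx cy eqxx.
Qed.

Fixpoint level_bound n := if n is m.+1 then level_bound m * (2 * (tau * tau)) else 1.

Fixpoint ball_bound n := if n is m.+1 then ball_bound m + level_bound m.+1 else 1.

Lemma colorable_level r n : colorable e (level adj r n) (level_bound n).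
Proof.
elim: n => [|n IH]; first by rewrite level0; apply/colorable1/und_irr.
exact: colorable_levelS IH.
Qed.

Lemma colorable_ball r n : colorable e (ball adj r n) (ball_bound n).
Proof.
elim: n => [|n IH]; first by rewrite -[ball _ _ _]setD0; apply: colorable_level 0.
rewrite ball_levelU; apply: colorableU IH _; exact: colorable_level.
Qed.

(** * Levels of arbitrary depth *)

(** A component of [D] is reached from its vertex of least rank through vertices of no smaller rank,
    so it lies in one ball of radius 4. Components are coloured separately. *)
Lemma colorable_local (D : {set V}) (u : V -> V) (rk : V -> nat) :
    (forall x, x \in D ->
       [set y | connect (restr e [set z in D | rk x <= rk z]) x y] \subset ball adj (u x) 4) ->
  colorable e D (ball_bound 4).
Proof.
move=> loc; have rsym := sym_connect_sym (restr_sym D (und_sym adj)).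
apply: (@colorable_glue _ _ _ (root (restr e D))) => [x y xD yD exy|t].
  by apply/(rootP rsym)/connect1; rewrite /restr /= xD yD.
set F := [set x in D | _]; have [->|[x0 x0F]] := set_0Vmem F.
  by apply: colorableS (colorable_ball t 4); rewrite ?sub0set.
have [m mF minm] := arg_minnP rk x0F; have /setIdP[mD /eqP rm] := mF.
apply: colorableS (colorable_ball (u m) 4) => //.
apply: subset_trans (loc m mD); apply/subsetP => x /setIdP[xD /eqP rx].
have /connectP[p + ->] : connect (restr e D) m x by apply/(rootP rsym); rewrite rm.
rewrite inE; elim/last_ind: p => [_|p z IH]; first exact: connect0.
rewrite rcons_path last_rcons => /andP[mp /and3P[lD zD elz]].
apply: connect_trans (IH mp) (connect1 _).
have inF y : y \in D -> connect (restr e D) m y -> rk m <= rk y.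
  move=> yD my; apply: minm; apply/setIdP; split=> //.
  by rewrite -rm eq_sym; apply/eqP/(rootP rsym).
have ml : connect (restr e D) m (last m p) by apply/connectP; exists p.
rewrite /restr /= !inE lD zD elz !inF //.
by apply: connect_trans ml (connect1 _); rewrite /restr /= lD zD.
Qed.

(** The first [ball_bound 4] separates vertices with the same first grandparent, each factor 2
    records the orientation of an edge, and the sum is for the vertices in the set [L] below and
    those outside it. *)
Definition deep_bound := ball_bound 4 * (2 * (2 * (ball_bound 4 + tau))).

Lemma colorable_level2 r j : colorable e (level adj r j.+2) deep_bound.
Proof.
pose Q g x y := [&& y \in level adj r j.+1, e g y & e y x].
have [g gP] := first_choice (fun g x => (g \in level adj r j) && [exists y, Q g x y]).
pose f x := odflt x [pick y | Q (g x) x y].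
have gl x : x \in level adj r j.+2 -> (g x \in level adj r j) && Q (g x) x (f x).
  move=> xl; have [y yl eyx] := level_parent xl; have [z zl ezy] := level_parent yl.
  have [|/andP[-> /existsP[y' Qy']] _] := gP z x.
    by rewrite zl; apply/existsP; exists y; rewrite /Q yl ezy.
  by rewrite /f; case: pickP => [//|/(_ y')]; rewrite Qy'.
have gmin h y x : h \in level adj r j -> y \in level adj r j.+1 -> e h y -> e y x ->
    enum_rank (g x) <= enum_rank h.
  move=> hl yl ehy eyx; have [|_ //] := gP h x.
  by rewrite hl; apply/existsP; exists y; rewrite /Q yl ehy.
(* Vertices with the same first grandparent lie within distance 2 of it. *)
have [c ck ce] : exists2 c : V -> nat,
    (forall x, x \in level adj r j.+2 -> c x < ball_bound 4) &
    forall x y, x \in level adj r j.+2 -> y \in level adj r j.+2 ->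
      g x = g y -> e x y -> c x != c y.
  apply: colorable_fibres => t; apply: colorableS (colorable_ball t 4) => //.
  apply/subsetP => x /setIdP[xl /eqP<-]; have [_ _ egf efx] := and4P (gl x xl).
  apply/(subsetP (ballS _ _ _))/(subsetP (ballS _ _ _)).
  by apply: ball_step efx; apply: ball_step egf; apply: ball0.
apply: (@colorable_prod _ _ c) => // c0.
apply: (@colorable_prod _ _ (fun x => nat_of_bool (adj (g x) (f x)))) => [x _|a].
  by case: (adj _ _).
apply: (@colorable_prod _ _ (fun x => nat_of_bool (adj (f x) x))) => [x _|b].
  by case: (adj _ _).
set D := [set x in _ | _].
have DP x : x \in D -> [/\ x \in level adj r j.+2, c x = c0,
    adj (g x) (f x) = a :> nat & adj (f x) x = b :> nat].
  by move=> /setIdP[/setIdP[/setIdP[xl /eqP cx] /eqP ax] /eqP bx].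
pose comp x := [set y | connect (restr e [set z in D | enum_rank (g x) <= enum_rank (g z)]) x y].
(* Outside [L], the path required by [no_two_tails] gets far enough. *)
pose L := [set x in D | comp x \subset ball adj (f x) 4].
rewrite -(setID D L); apply: colorableU.
  apply: (@colorable_local _ f (fun x => enum_rank (g x))) => x /setIP[_ /setIdP[xD]].
  apply: subset_trans; apply/subsetP => y; rewrite !inE; apply: connect_restrS.
  by apply/subsetP => z /setIdP[/setIP[zD _] le_z]; apply/setIdP.
apply: (colorable_nested (f := f) (rk := fun x => enum_rank (g x))) => [x|x y].
  by move=> /setDP[/DP[/gl/and4P[_ _ _]]]; rewrite und_sym.
move=> /setDP[xD _] /setDP[yD /negP nyL] exy.
have [xl cx ax bx] := DP x xD; have [yl cy ay by_] := DP y yD.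
have [gxl fxl egx efx] := and4P (gl x xl); have [gyl fyl egy efy] := and4P (gl y yl).
rewrite leq_eqVlt => /predU1P[/val_inj/enum_rank_inj eqg|ltg].
  by have := ce x y xl yl eqg exy; rewrite cx cy eqxx.
apply: contraT => nfyx.
(* Otherwise [g x], which precedes [g y] and hence [g z], would be a grandparent of [z]. *)
have nfx z : z \in D -> enum_rank (g y) <= enum_rank (g z) -> ~~ e (f x) z.
  move=> zD le_z; apply/negP => efz.
  by have := leq_trans ltg (leq_trans le_z (gmin _ _ _ gxl fxl egx efz)); rewrite ltnn.
have dar p q : e p q -> darc adj (adj p q) p q.
  by rewrite /darc /und; case: (adj p q).
have bool_inj (p q : bool) : p = q :> nat -> p = q by case: p; case: q.
have eff : e (f x) (f y).
  apply: (adjacent_parents xl yl fxl fyl exy efx efy _ _ (dar _ _ efx)).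
  - exact: nfx.
  - by rewrite und_sym.
  - by rewrite (bool_inj _ _ (etrans bx (esym by_))); apply: dar.
have [z zc zfar] : exists2 z, z \in comp y & z \notin ball adj (f y) 4.
  by apply/subsetPn/negP => sub; apply: nyL; apply/setIdP.
pose S := [set z in D | enum_rank (g y) <= enum_rank (g z)].
have yS : y \in S by apply/setIdP.
rewrite inE -/S in zc; have zS := connect_restr_mem yS zc.
have [zD _] := setIdP zS; have [zl cz az bz] := DP z zD.
have [gzl fzl egz efz] := and4P (gl z zl).
(* Here [f x] and [f y] act as [u] and [w]; the common tail starts at [y], leads through [S] to [z]
   and ends at [f z]. *)
exfalso; apply: (@no_two_tails r j (adj (g x) (f x)) S
  (f x) (f y) (g x) (g y) y z (f z) (g z)) => //.
- by move=> t /setIdP[/DP[]].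
- apply/negP => egfy.
  by have := leq_trans ltg (gmin _ _ _ gxl fyl egfy efy); rewrite ltnn.
- exact: dar.
- by rewrite (bool_inj _ _ (etrans ax (esym ay))); apply: dar.
- by rewrite (bool_inj _ _ (etrans ax (esym az))); apply: dar.
- by move=> t /setIdP[tD]; apply: nfx.
Qed.

(** Edges join vertices of equal or consecutive levels of one component, so after a split by the
    parity of the level they stay inside one level. The sum covers level 0, level 1 and any deeper
    level. *)
Lemma colorable_graph : colorable e setT (2 * (level_bound 0 + level_bound 1 + deep_bound)).
Proof.
have esym := sym_connect_sym (und_sym adj).
have [n nP] : exists n : V -> nat, forall x, x \in level adj (root e x) (n x).
  apply: (@fin_all_exists _ (fun=> nat) (fun x n => x \in level adj (root e x) n)) => x.
  by apply: ex_level; rewrite esym connect_root.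
apply: (@colorable_prod _ _ (fun x => nat_of_bool (odd (n x)))) => [x _|i].
  by case: (odd _).
apply: (@colorable_glue _ _ _ (fun x => (root e x, n x))) => [x y|[r m]].
  move=> /setIdP[_ /eqP ox] /setIdP[_ /eqP oy] exy.
  have eqr : root e x = root e y by apply/(rootP esym)/connect1.
  have := level_edge (nP x); rewrite eqr => /(_ _ _ (nP y) exy) le_yx.
  have := level_edge (nP y); rewrite -eqr => /(_ _ _ (nP x)).
  rewrite und_sym => /(_ exy) le_xy; congr (_, _); apply/eqP.
  move: ox; rewrite -oy; rewrite eqn_leq.
  case: (ltngtP (n x) (n y)) => // [lt|lt].
    have -> : n y = (n x).+1 by apply/eqP; rewrite eqn_leq le_yx.
    by rewrite /=; case: (odd _).
  have -> : n x = (n y).+1 by apply/eqP; rewrite eqn_leq le_xy.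
  by rewrite /=; case: (odd _).
apply: (@colorableS _ _ _ (level adj r m)).
- by apply/subsetP => x /setIdP[_ /eqP[<- <-]].
- exact: leqnn.
case: m => [|[|m]].
- by apply: colorableS (colorable_level r 0); rewrite ?subxx // -addnA leq_addr.
- by apply: colorableS (colorable_level r 1); rewrite ?subxx // -addnA addnCA leq_addr.
- by apply: colorableS (colorable_level2 r m); rewrite ?subxx // leq_addl.
Qed.

End NoHole.

(** * Induction on the clique number, and the chromatic number *)

(** The vertex type is kept and vertices outside [B] become isolated, which avoids digraphs on
    subtypes. *)
Definition induced (V : finType) (adj : rel V) (B : {set V}) : rel V :=
  [rel x y | [&& x \in B, y \in B & adj x y]].

Lemma und_induced (V : finType) (adj : rel V) (B : {set V}) x y :
  und (induced adj B) x y = [&& x \in B, y \in B & und adj x y].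
Proof.
by rewrite /und /induced /=; case: (x \in B); case: (y \in B) => //=; rewrite ?andbF.
Qed.

(** Every vertex of a hole has a neighbour on it, so the hole lies in [B], where the two digraphs
    agree. *)
Lemma induced_long_hole (V : finType) (adj : rel V) (B : {set V}) s :
    long_hole (induced adj B) s -> disoriented_hole (induced adj B) s ->
  long_hole adj s /\ disoriented_hole adj s.
Proof.
move=> [[us s4 holeP] s5] [ndir nalt].
have s0 : 0 < size s by apply: leq_trans s4.
have sB x : x \in s -> x \in B.
  move=> xs; have := holeP x (index x s) ((index x s).+1 %% size s).
  rewrite index_mem ltn_mod eqxx nth_index // und_induced => /(_ xs s0).
  by case/and3P.
have deg v : v \in s -> outdeg_in (induced adj B) s v = outdeg_in adj s v.
  move=> vs; apply: eq_card => u; rewrite !inE /induced /= sB //=.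
  by case: (boolP (u \in s)) => //= /sB->.
split; first split=> //; first split=> // x0 i j si sj.
  by rewrite -(holeP x0) // und_induced !sB ?mem_nth.
split=> [dir|alt]; [apply: ndir|apply: nalt] => v vs; rewrite deg //.
  exact: dir.
exact: alt.
Qed.

(** The bound [tau] is chosen before the digraph, since the induction hypothesis is applied to the
    digraph induced on [B]. *)
Lemma clique_colorable kappa : exists tau, forall (V : finType) (adj : rel V),
  digraph adj -> (forall s, long_hole adj s -> ~ disoriented_hole adj s) ->
  forall B : {set V},
    (forall S : {set V}, S \subset B -> cliqueb adj S -> #|S| <= kappa) ->
  colorable (und adj) B tau.
Proof.
elim: kappa => [|kappa [tau IH]].
  exists 0 => V adj _ _ B cliqueB; exists (fun=> 0) => [x xB|x y xB]; exfalso;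
  have := cliqueB [set x]; rewrite sub1set xB cards1 => /(_ isT); rewrite ltnn => H;
  by apply: notF; apply: H; apply/forall_inP => z; rewrite inE => /eqP->;
     apply/forall_inP => t; rewrite inE => /eqP->; rewrite eqxx.
exists (2 * (level_bound tau 0 + level_bound tau 1 + deep_bound tau)).
move=> V adj adjP no_hole B cliqueB; pose adjB := induced adj B.
have adjBP : digraph adjB.
  by move=> x y /and3P[xB yB xy]; rewrite /adjB /induced /= xB yB adjP.
have no_holeB s : long_hole adjB s -> ~ disoriented_hole adjB s.
  by move=> ls ds; have [] := induced_long_hole ls ds; apply: no_hole.
have [|c ck ce] := @colorable_graph V adjB adjBP no_holeB kappa tau (IH V adjB adjBP no_holeB).
  (* A clique not inside [B] contains an isolated vertex, hence is a single vertex. *)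
  move=> S clS; have [SB|/subsetPn[x xS xB]] := boolP (S \subset B).
    apply: cliqueB => //; apply/forall_inP => x xS; apply/forall_inP => y yS.
    apply/implyP => nxy; move/forall_inP: clS => /(_ x xS)/forall_inP/(_ y yS).
    by rewrite nxy und_induced => /and3P[].
  apply: (@leq_trans #|[set x]|); last by rewrite cards1.
  apply/subset_leq_card/subsetP => y yS; rewrite inE; apply: contraT => nyx.
  move/forall_inP: clS => /(_ y yS)/forall_inP/(_ x xS).
  by rewrite nyx und_induced (negPf xB) andbF.
exists c => [x xB|x y xB yB exy]; first by rewrite ck ?inE.
by apply: ce; rewrite ?inE // und_induced xB yB.
Qed.

Lemma chi_colorable (V : finType) (adj : rel V) c :
  colorable (und adj) [set: V] c -> chi adj <= c.
Proof.
move=> [f fc fe]; have fT x : f x < c by apply: fc; rewrite inE.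
have colc : colorableb adj c.
  apply/existsP; exists [ffun x => Ordinal (fT x)].
  apply/forallP => x; apply/forallP => y; apply/implyP => exy; rewrite !ffunE.
  by have := fe x y (in_setT x) (in_setT y) exy; apply: contra => /eqP[->].
(* The search for [chi] runs over the numbers up to [#|V|]; for larger [c] the length of that list
   is already a bound. *)
rewrite /chi; have [lt_cV|le_Vc] := ltnP c #|V|.+1.
  rewrite leqNgt; apply/negP => /(before_find 0).
  by rewrite nth_iota // add0n colc.
by apply: leq_trans (find_size _ _) _; rewrite size_iota.
Qed.

Theorem theorem2p1 :
  forall kappa : nat, exists c : nat,
    forall (V : finType) (adj : rel V),
      digraph adj -> omega adj <= kappa -> c < chi adj ->
      exists s : seq V, long_hole adj s /\ disoriented_hole adj s.
Proof.
move=> kappa; have [tau colP] := clique_colorable kappa.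
exists tau => V adj adjP omegaP; rewrite ltnNge => /negP nchi.
apply: NNPP => no_hole; apply/nchi/chi_colorable/colP => // [s ls ds|S _ clS].
  by apply: no_hole; exists s.
by apply: leq_trans omegaP; apply: (@leq_bigmax_cond _ _ (fun S : {set V} => #|S|)) clS.
Qed.
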